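(* Let $n, k \ge 2$ be integers, let $S = \{0, 1, 2, \dots, n-1\}$ and let $\Gamma_n = S \times S \subseteq \mathbb{R}^2$ be the standard $n \times n$ grid. Then, as $n, k \to \infty$, \[ (2 - e^{-1/2} + o(1))\,k(n-1) \le \operatorname{cov}_k(\Gamma_n) \le (\sqrt{2} + o(1))\,k(n-1). \]
   Context: For finite $S_1, S_2 \subseteq \mathbb{R}$ with $0 \in S_1 \cap S_2$, let $\Gamma = S_1 \times S_2$. For an integer $k \ge 1$, a $k$-cover of $\Gamma$ is a finite multiset $\mathcal{H}$ of (affine) lines in $\mathbb{R}^2$ such that every point of $\Gamma \setminus \{(0,0)\}$ is contained in at least $k$ of the lines (counted with multiplicity), while no line of $\mathcal{H}$ contains $(0,0)$. $\operatorname{cov}_k(\Gamma)$ denotes the minimum cardinality (counted with multiplicity) of a $k$-cover of $\Gamma$. Here $o(1)$ denotes a quantity depending on $n$ and $k$ that tends to $0$ as both $n$ and $k$ tend to infinity (with no assumed relation between their rates of growth). *)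

(* Defs.v *)
From HB Require Import structures.
From mathcomp Require Import all_boot all_order all_algebra.
From mathcomp Require Import finmap multiset.
From mathcomp Require Import all_classical all_reals all_analysis.
Set Implicit Arguments.
Unset Strict Implicit.
Unset Printing Implicit Defensive.
Import Order.TTheory GRing.Theory Num.Theory.
Import numFieldNormedType.Exports.
Local Open Scope ring_scope.

Definition is_line (R : realType) (L : set (R * R)) : Prop :=
  exists a b c : R, (a, b) != (0, 0) /\ L = [set p | a * p.1 + b * p.2 = c]%classic.

(* A multiset coerces to the sequence of its elements, repeated according to
   multiplicity, so [count] and [size] below count with multiplicity. *)
Definition kcover (R : realType) (k : nat) (G : {fset R * R})
    (H : {mset set (R * R)}%mset) : Prop :=
  [/\ forall L, L \in H -> is_line L,
      forall p, p \in G -> p != (0, 0) ->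
        (k <= count (fun L : set (R * R) => p \in L) H)%N
    & forall L : set (R * R), L \in H -> (0, 0) \notin L].

(* For each nonzero p in G, take k copies of the line through p
   perpendicular to the vector p. *)
Lemma kcover_exists (R : realType) (k : nat) (G : {fset R * R}) :
  exists m : nat, `[< exists2 H, kcover k G H & size H = m >].
Proof.
pose l (p : R * R) : set (R * R) :=
  [set q | p.1 * q.1 + p.2 * q.2 = p.1 ^+ 2 + p.2 ^+ 2]%classic.
pose s := flatten [seq nseq k (l p) | p <- G & p != (0, 0)].
have sP L : L \in s -> exists2 p, p != (0, 0) & L = l p.
  case/flatten_mapP => p; rewrite mem_filter => /andP[p0 _].
  by rewrite mem_nseq => /andP[_ /eqP ->]; exists p.
exists (size (seq_mset s)); apply/asboolP; exists (seq_mset s) => //; split.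
- move=> L; rewrite (perm_mem (perm_eq_seq_mset s)) => /sP[[a b] p0 ->].
  by exists a, b, (a ^+ 2 + b ^+ 2).
- move=> p pG p0; rewrite (permP (perm_eq_seq_mset s)).
  have: p \in [seq q <- G | q != (0, 0)] by rewrite mem_filter p0.
  rewrite /s; elim: [seq q <- G | _] => //= q t IH.
  rewrite inE count_cat => /orP[/eqP <-|/IH]; last first.
    by move=> kt; rewrite (leq_trans kt)// leq_addl.
  by rewrite count_nseq mem_set ?mul1n ?leq_addr// /l /= !expr2.
- move=> L; rewrite (perm_mem (perm_eq_seq_mset s)) => /sP[[a b] p0 ->].
  apply/negP; rewrite inE /l /= !mulr0 addr0 => /esym/eqP.
  rewrite paddr_eq0 ?sqr_ge0// !sqrf_eq0 => /andP[/eqP a0 /eqP b0].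
  by move: p0; rewrite a0 b0 eqxx.
Qed.

Definition cov (R : realType) (k : nat) (G : {fset R * R}) : nat :=
  ex_minn (kcover_exists k G).

Definition segment (R : realType) (n : nat) : {fset R} :=
  [fset (i%:R : R) | i in iota 0 n]%fset.

Definition std_grid (R : realType) (n : nat) : {fset R * R} :=
  (segment R n `*` segment R n)%fset.

(* Main.v *)
Require Import Defs.
From HB Require Import structures.
From mathcomp Require Import all_boot all_order all_algebra.
From mathcomp Require Import finmap multiset.
From mathcomp Require Import all_classical all_reals all_analysis.
From mathcomp Require Import zify ring lra.
Import Order.TTheory GRing.Theory Num.Theory.
Import numFieldNormedType.Exports.
Local Open Scope classical_set_scope.
Local Open Scope ring_scope.

(** Write [m = n - 1]. Dividing by [k], covering the grid is the linear program
    of minimising the total weight of a family of lines off the origin under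
    which every nonzero grid point receives weight at least 1; its dual packs
    weights on the grid points so that no line off the origin carries more
    than 1.

    Lower bound ([cov_ge]). By weak duality ([weak_duality]), it suffices to
    exhibit a packing of total weight about [(2 - e^(-1/2)) m]. Put weight 1/2
    on each of the [2 m] nonzero axis points, and spread weight 1 uniformly over
    each of the diagonals [x + y = m + 1 + t], [t < J], where the diagonal of
    index [t] has [m - t] points. The total is [m + J]. A line that is not one
    of these diagonals meets each of them at most once, hence takes at most
    [\sum_(t < J) 1 / (m - t)], about [ln (m / (m - J))], from them; this is at
    most 1/2 exactly up to [J] about [(1 - e^(-1/2)) m], which is where the
    constant comes from. Lines with two axis points are harmless, since inside
    the grid they stay in the triangle [x + y <= m]. See [dual_weights_line].

    Upper bound ([cov_le]). Only vertical, horizontal and diagonal lines are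
    used: with [l = sqrt 2 * m], the lines [x = i] and [y = i] get weight
    [i / l] and the line [x + y = h] gets weight [max(0, 1 - h / l)]. The point
    [(i, j)] then receives at least [i / l + j / l + 1 - (i + j) / l = 1], and
    the total weight is about [m ^ 2 / l + l / 2], which the choice of [l]
    minimises, with value [sqrt 2 * m]. Multiplying by [k] and rounding up
    costs at most one extra line for each of the [4 m] lines in use, whence an
    error [O(1 / m + 1 / k)] relative to [k m]: it vanishes without any relation
    between the growth of [n] and that of [k]. *)

(** * Indicator sums, grid points and optimal covers *)

Lemma natr_count (R : realType) (T : Type) (a : pred T) (s : seq T) :
  (count a s)%:R = \sum_(x <- s) (a x)%:R :> R.
Proof.
by elim: s => [|x s IH] /=; rewrite ?big_nil ?big_cons // natrD IH.
Qed.

Lemma sum_indic_le1 (R : realType) (P : pred nat) (n : nat) :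
  (forall i j, (i < n)%N -> (j < n)%N -> P i -> P j -> i = j) ->
  \sum_(0 <= i < n) (P i)%:R <= 1 :> R.
Proof.
elim: n => [|n IH] Puniq; first by rewrite big_nil.
rewrite big_nat_recr //=; case Pn: (P n); last first.
  by rewrite addr0; apply: IH => i j ? ?; apply: Puniq; exact: ltnW.
rewrite big_nat big1 ?add0r // => i /andP[_ lt_in].
case Pi: (P i) => //.
by move: (lt_in); rewrite (Puniq i n (ltnW lt_in) (ltnSn n) Pi Pn) ltnn.
Qed.

Lemma mem_std_grid (R : realType) (m i j : nat) :
  (i <= m)%N -> (j <= m)%N -> (i%:R, j%:R) \in std_grid R m.+1.
Proof.
move=> le_im le_jm; rewrite /std_grid in_fsetM /=.
have iotaP h : (h <= m)%N -> h \in iota 0 m.+1 by rewrite mem_iota.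
by apply/andP; split; apply: in_imfset; apply: iotaP.
Qed.

Lemma std_gridP (R : realType) (m : nat) (p : R * R) :
  p \in std_grid R m.+1 ->
  exists i j : nat, [/\ (i <= m)%N, (j <= m)%N & p = (i%:R, j%:R)].
Proof.
case: p => x y; rewrite /std_grid in_fsetM /= => /andP[].
have iotaP h : h \in iota 0 m.+1 -> (h <= m)%N by rewrite mem_iota.
move=> /imfsetP[i /iotaP ? ->] /imfsetP[j /iotaP ? ->].
by exists i, j.
Qed.

Lemma cov_kcover (R : realType) (k : nat) (G : {fset R * R}) :
  exists2 H, kcover k G H & size H = cov k G.
Proof. by rewrite /cov; case: ex_minnP => n /asboolP. Qed.

Lemma cov_le_size (R : realType) (k : nat) (G : {fset R * R}) H :
  kcover k G H -> (cov k G <= size H)%N.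
Proof.
rewrite /cov => HH; case: ex_minnP => n _; apply.
by apply/asboolP; exists H.
Qed.

(** * Lower bound: packing weights on grid points *)

(** Double counting of the weighted incidences between points and lines. *)
Lemma weak_duality (R : realType) (k : nat) (G : {fset R * R})
    (s : seq (R * (R * R))) :
  (forall q, q \in s -> [/\ 0 <= q.1, q.2 \in G & q.2 != (0, 0)]) ->
  (forall L : set (R * R), is_line L -> (0, 0) \notin L ->
     \sum_(q <- s) q.1 * (q.2 \in L)%:R <= 1) ->
  k%:R * \sum_(q <- s) q.1 <= (cov k G)%:R.
Proof.
move=> sP Lle1; have [H [Hline Hcov H0] <-] := cov_kcover R k G.
have -> : (size H)%:R = \sum_(L <- H) 1 :> R.
  by rewrite big_const_seq count_predT iter_addr_0.
apply: (@le_trans _ _ (\sum_(L <- H) \sum_(q <- s) q.1 * (q.2 \in L)%:R)).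
  rewrite exchange_big mulr_sumr !big_seq; apply: ler_sum => q qs.
  have [q1 qG q0] := sP q qs.
  rewrite -mulr_sumr mulrC ler_wpM2l //.
  rewrite -(natr_count R _ (fun L : set (R * R) => q.2 \in L)) ler_nat.
  exact: Hcov.
rewrite !big_seq; apply: ler_sum => L LH.
by apply: Lle1; [exact: Hline | exact: H0].
Qed.

(** Each term satisfies [1 / x <= ln x - ln (x - 1)], so the sum telescopes to at
    most [ln (m / (m - J))], and the bound on [J] says [m - J >= m e^(-1/2)]. *)
Lemma sum_inv_le_half (R : realType) (m J : nat) :
  (0 < m)%N -> J%:R <= m%:R * (1 - expR (- (1 / 2))) :> R ->
  (J < m)%N /\ \sum_(0 <= t < J) (m - t)%:R^-1 <= 1 / 2 :> R.
Proof.
move=> m_gt0 J_le; have m0 : 0 < m%:R :> R by rewrite ltr0n.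
have e0 := expR_gt0 (- (1 / 2) : R).
have ltJm : (J < m)%N by rewrite -(ltr_nat R); nra.
split=> //.
have tail i : (i <= J)%N ->
    \sum_(0 <= t < i) (m - t)%:R^-1 <= ln m%:R - ln (m - i)%:R :> R.
  elim: i => [|i IH] iJ; first by rewrite big_nil subn0 subrr.
  rewrite big_nat_recr //=.
  have := IH (ltnW iJ).
  have x0 : 0 < (m - i)%:R :> R by rewrite ltr0n; lia.
  have y0 : 0 < (m - i.+1)%:R :> R by rewrite ltr0n; lia.
  have xy : (m - i.+1)%:R = (m - i)%:R - 1 :> R.
    have -> : (m - i = (m - i.+1).+1)%N by lia.
    by rewrite -natr1 addrK.
  have := @le_ln1Dx R (- (m - i)%:R^-1).
  have -> : 1 + - (m - i)%:R^-1 = (m - i.+1)%:R / (m - i)%:R :> R.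
    by rewrite xy; field; rewrite gt_eqF.
  rewrite ln_div ?posrE // => /(_ _) lnle IHi.
  have : -1 < - (m - i)%:R^-1 :> R.
    by rewrite ltrN2 invf_lt1 //; lra.
  move=> /lnle; lra.
have := tail J (leqnn _).
have : ln (m%:R * expR (- (1 / 2))) <= ln (m - J)%:R :> R.
  rewrite ler_ln ?posrE ?mulr_gt0 // ?ltr0n ?subn_gt0 // natrB 1?ltnW //.
  by move: J_le; lra.
rewrite lnM ?posrE // expRK; lra.
Qed.

(** A list of pairs of a weight and a grid point. In the last block, [r] runs
    over all the [m - t] grid points of the diagonal [x + y = m + 1 + t]. *)
Definition dual_weights (R : realType) (m J : nat) : seq (R * (R * R)) :=
  [seq (1 / 2, (i.+1%:R, 0)) | i <- index_iota 0 m] ++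
  [seq (1 / 2, (0, i.+1%:R)) | i <- index_iota 0 m] ++
  [seq ((m - t)%:R^-1, ((t.+1 + r)%:R, (m - r)%:R))
     | t <- index_iota 0 J, r <- index_iota 0 (m - t)].

Lemma big_dual_weights (R : realType) (m J : nat) (F : R * (R * R) -> R) :
  \sum_(q <- dual_weights R m J) F q =
  \sum_(0 <= i < m) F (1 / 2, (i.+1%:R, 0)) +
  (\sum_(0 <= i < m) F (1 / 2, (0, i.+1%:R)) +
   \sum_(0 <= t < J) \sum_(0 <= r < m - t)
      F ((m - t)%:R^-1, ((t.+1 + r)%:R, (m - r)%:R))).
Proof. by rewrite /dual_weights !big_cat !big_map big_allpairs_dep. Qed.

Lemma dual_weights_total (R : realType) (m J : nat) :
  (J < m)%N -> \sum_(q <- dual_weights R m J) q.1 = m%:R + J%:R.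
Proof.
move=> Jm; rewrite big_dual_weights /=.
rewrite !sumr_const_nat subn0.
rewrite (@eq_big_nat _ _ _ _ _ _ (fun=> 1)) => [|t /andP[_ tJ]].
  by rewrite sumr_const_nat subn0 -(mulr_natr (1 / 2)); field.
rewrite sumr_const_nat subn0 -[LHS]mulr_natr mulVf // pnatr_eq0; lia.
Qed.

(** The chord of a line between the axis points [(u, 0)] and [(0, v)] is the
    only part of it in the quadrant [x, y >= 0], and both of its ends lie in
    the convex region [x + y <= M]. *)
Lemma below_chord (R : realType) (a b c u v M x y : R) :
  c != 0 -> 0 < u -> 0 < v -> u <= M -> v <= M -> 0 <= x -> 0 <= y ->
  a * u = c -> b * v = c -> a * x + b * y = c -> x + y <= M.
Proof.
move=> c0 u0 v0 uM vM x0 y0 au bv e; have M0 : 0 < M by lra.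
have e1 : x / u + y / v = 1.
  apply: (mulfI c0); rewrite mulr1 -[RHS]e mulrDr.
  by rewrite -{1}au -{1}bv; field; rewrite !gt_eqF.
have h1 : x / M <= x / u by rewrite ler_wpM2l // lef_pV2 ?posrE //; lra.
have h2 : y / M <= y / v by rewrite ler_wpM2l // lef_pV2 ?posrE //; lra.
have : x / M + y / M <= 1 by lra.
rewrite -mulrDl ler_pdivrMr //; lra.
Qed.

(** The weights form a fractional packing. A line [x + y = s] carries at most
    two axis points (weight 1 in all) or one weighted diagonal (weight 1), but
    not both. Any other
    line meets each diagonal at most once, so it collects at most
    [\sum_t 1 / (m - t) <= 1 / 2] from the diagonals; that leaves room for one
    axis point, and a line through two axis points misses the diagonals
    altogether, by [below_chord]. *)
Lemma dual_weights_line (R : realType) (m J : nat) (L : set (R * R)) :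
  (J < m)%N -> \sum_(0 <= t < J) (m - t)%:R^-1 <= 1 / 2 :> R ->
  is_line L -> (0, 0) \notin L ->
  \sum_(q <- dual_weights R m J) q.1 * (q.2 \in L)%:R <= 1.
Proof.
move=> Jm sumJ [a [b [c [ab0 LE]]]] L0.
have memL x y : ((x, y) \in L) = (a * x + b * y == c).
  by rewrite LE; apply/idP/eqP; rewrite inE.
have c0 : c != 0 by move: L0; rewrite memL !mulr0 addr0 eq_sym.
rewrite big_dual_weights /=.
under eq_bigr do rewrite memL mulr0 addr0.
under [X in _ + (X + _)]eq_bigr do rewrite memL mulr0 add0r.
under [X in _ + (_ + X)]eq_bigr do
  (under eq_bigr do rewrite memL; rewrite -mulr_sumr).
rewrite -!mulr_sumr.
set X := \sum_(0 <= i < m) _; set Y := \sum_(0 <= i < m) _.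
set D := \sum_(0 <= t < J) _.
have axis_le1 (d : R) : \sum_(0 <= i < m) (d * i.+1%:R == c)%:R <= 1 :> R.
  apply: sum_indic_le1 => i j _ _ /eqP di /eqP dj.
  have d0 : d != 0 by apply: contra_neq c0 => d0; rewrite -di d0 mul0r.
  move: di; rewrite -dj => /(mulfI d0) /eqP; rewrite eqr_nat.
  by move=> /eqP[].
have axis_dich (d : R) : \sum_(0 <= i < m) (d * i.+1%:R == c)%:R = 0 :> R \/
    exists2 i, (i < m)%N & d * i.+1%:R = c.
  have [/hasP[i]|/hasPn none] := boolP (has (fun i => d * i.+1%:R == c) (iota 0 m)).
    by rewrite mem_iota => im /eqP; right; exists i.
  left; rewrite big_nat big1 // => i /andP[_ im].
  by have /negPf -> : d * i.+1%:R != c by apply: none; rewrite mem_iota.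
have X1 : X <= 1 := axis_le1 a.
have Y1 : Y <= 1 := axis_le1 b.
have diagE t r : (t < J)%N -> (r < m - t)%N ->
    (t.+1 + r)%:R + (m - r)%:R = (m.+1 + t)%:R :> R.
  by move=> tJ rm; rewrite -natrD; congr _%:R; lia.
(* [X] and [Y] count the axis points on the line, [D] is what it takes from the
   weighted diagonals; the case [a = b] is that of the lines [x + y = s]. *)
have [eab|nab] := eqVneq a b.
- pose P t := a * (m.+1 + t)%:R == c.
  have DE : D = \sum_(0 <= t < J) (P t)%:R.
    apply: eq_big_nat => t /andP[_ tJ].
    rewrite (@eq_big_nat _ _ _ _ _ _ (fun=> (P t)%:R)) => [|r /andP[_ rm]].
      rewrite sumr_const_nat subn0 -(mulr_natl (P t)%:R) mulrA mulVf ?mul1r //.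
      by rewrite pnatr_eq0; lia.
    by rewrite -eab -mulrDr diagE.
  have inj i j : a * i%:R = c -> a * j%:R = c -> i = j.
    move=> di dj; have a0 : a != 0.
      by apply: contra_neq c0 => a0; rewrite -di a0 mul0r.
    by move: di; rewrite -dj => /(mulfI a0) /eqP; rewrite eqr_nat => /eqP.
  have [/hasP[t]|/hasPn none] := boolP (has P (iota 0 J)).
    rewrite mem_iota => tJ /eqP Pt.
    have [X0 | [i im ci]] := axis_dich a; last by have := inj _ _ Pt ci; lia.
    have -> : X = 0 := X0.
    have -> : Y = 0 by rewrite /Y -eab X0.
    have : D <= 1.
      rewrite DE; apply: sum_indic_le1 => i j _ _ /eqP di /eqP dj.
      by have := inj _ _ di dj; lia.
    lra.
  have -> : D = 0.
    rewrite DE big_nat big1 // => t /andP[_ tJ].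
    by have /negPf -> : ~~ P t by apply: none; rewrite mem_iota.
  lra.
- have D1 : D <= 1 / 2.
    apply: le_trans sumJ; apply: ler_sum => t _.
    rewrite ler_piMr ?invr_ge0 //.
    apply: sum_indic_le1 => r r' rm r'm /eqP er /eqP er'.
    have nab' : a - b != 0 by rewrite subr_eq0.
    apply/eqP; rewrite -(eqr_nat R); apply/eqP/(mulfI nab').
    by move: er er'; rewrite !natrD !natrB; [lra | lia | lia].
  have [X0|[i im ai]] := axis_dich a.
    have -> : X = 0 := X0.
    lra.
  have [Y0|[j jm bj]] := axis_dich b.
    have -> : Y = 0 := Y0.
    lra.
  have -> : D = 0; last lra.
  rewrite /D big_nat big1 // => t /andP[_ tJ].
  rewrite big_nat big1 ?mulr0 // => r /andP[_ rm].
  case: eqP => // e; exfalso.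
  have : (t.+1 + r)%:R + (m - r)%:R <= m%:R :> R.
    by apply: (below_chord R a b c i.+1%:R j.+1%:R); rewrite ?ler_nat.
  by rewrite diagE // ler_nat; lia.
Qed.

Lemma cov_ge (R : realType) (k m : nat) : (0 < m)%N ->
  k%:R * (m%:R * (2 - expR (- (1 / 2))) - 1) <= (cov k (std_grid R m.+1))%:R :> R.
Proof.
move=> m0; pose z : R := m%:R * (1 - expR (- (1 / 2))).
have z0 : 0 <= z.
  rewrite mulr_ge0 // subr_ge0 -expR0 ler_expR; lra.
have /andP[Jle zJ] := truncn_itv z0.
set J := Num.truncn z in Jle zJ.
have [Jm sumJ] := sum_inv_le_half R m J m0 Jle.
apply: (@le_trans _ _ (k%:R * \sum_(q <- dual_weights R m J) q.1)).
  rewrite ler_wpM2l // dual_weights_total //.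
  by move: zJ; rewrite -natr1 /z; lra.
apply: weak_duality => [q|L lineL L0]; last exact: dual_weights_line.
rewrite /dual_weights !mem_cat => /or3P[/mapP|/mapP|/allpairsPdep].
- move=> [i + ->]; rewrite mem_index_iota => /andP[_ im] /=.
  split; [by lra | exact: (mem_std_grid R m i.+1 0) |].
  by rewrite xpair_eqE pnatr_eq0.
- move=> [i + ->]; rewrite mem_index_iota => /andP[_ im] /=.
  split; [by lra | exact: (mem_std_grid R m 0 i.+1) |].
  by rewrite xpair_eqE pnatr_eq0 andbF.
- move=> [t [r []]]; rewrite !mem_index_iota => /andP[_ tJ] /andP[_ rm] -> /=.
  split; [by rewrite invr_ge0 | apply: mem_std_grid; lia |].
  by rewrite xpair_eqE pnatr_eq0.
Qed.

(** * Upper bound: lines in three directions *)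

Definition line (R : realType) (a b c : R) : set (R * R) :=
  [set p | a * p.1 + b * p.2 = c].

Lemma mem_line (R : realType) (a b c : R) (p : R * R) :
  (p \in line R a b c) = (a * p.1 + b * p.2 == c).
Proof. by apply/idP/eqP; rewrite inE. Qed.

(** The offsets are [1, ..., N], so that none of the lines passes through the
    origin; the one of offset [i + 1] has multiplicity [g i]. *)
Definition parallel_lines (R : realType) (a b : R) (g : nat -> nat) (N : nat) :
    seq (set (R * R)) :=
  flatten [seq nseq (g i) (line R a b i.+1%:R) | i <- iota 0 N].

Lemma parallel_linesP (R : realType) (a b : R) g N (l : set (R * R)) :
  l \in parallel_lines R a b g N -> exists i : nat, l = line R a b i.+1%:R.
Proof.
by case/flatten_mapP => i _; rewrite mem_nseq => /andP[_ /eqP ->]; exists i.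
Qed.

Lemma count_parallel_lines (R : realType) (a b : R) g N (p : R * R) (i : nat) :
  a * p.1 + b * p.2 = i.+1%:R -> (i < N)%N ->
  (g i <= count (fun l : set (R * R) => p \in l) (parallel_lines R a b g N))%N.
Proof.
move=> pl iN; have : i \in iota 0 N by rewrite mem_iota.
rewrite /parallel_lines; elim: (iota 0 N) => //= h s IH.
rewrite inE count_cat => /orP[/eqP <-|/IH]; last first.
  by move=> /leq_trans; apply; rewrite leq_addl.
by rewrite count_nseq mem_line pl eqxx mul1n leq_addr.
Qed.

Definition round_up (R : realType) (x : R) : nat := (Num.truncn x).+1.

Lemma round_up_ge (R : realType) (x : R) : x <= (round_up R x)%:R.
Proof. exact/ltW/truncnS_gt. Qed.

Lemma round_up_le (R : realType) (x : R) : (round_up R x)%:R <= Num.max 0 x + 1.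
Proof.
rewrite /round_up -natr1 lerD2r.
have [x0|x0] := leP 0 x; first by rewrite truncn_le.
have /truncn0Pn -> // : ~~ (1 <= x) by rewrite -ltNge; lra.
Qed.

Lemma size_parallel_lines (R : realType) (a b : R) g N :
  size (parallel_lines R a b g N) = (\sum_(0 <= i < N) g i)%N.
Proof.
rewrite /parallel_lines size_flatten /shape -map_comp sumnE big_map.
by rewrite /index_iota subn0; apply: eq_bigr => i _ /=; rewrite size_nseq.
Qed.

Lemma size_round_up_lines (R : realType) (a b : R) (f : nat -> R) N :
  (size (parallel_lines R a b (fun i => round_up R (f i)) N))%:R <=
    \sum_(0 <= i < N) Num.max 0 (f i) + N%:R :> R.
Proof.
have -> : N%:R = \sum_(0 <= i < N) 1 :> R by rewrite sumr_const_nat subn0.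
rewrite size_parallel_lines natr_sum -big_split /=.
by apply: ler_sum => i _; exact: round_up_le.
Qed.

(** A Riemann sum of a decreasing function is at most its integral, here the
    area [l / 2] of a triangle; [- phi] is the primitive of the summand. *)
Lemma sum_max_le (R : realType) (l : R) (N : nat) : 0 < l ->
  \sum_(0 <= i < N) Num.max 0 (1 - i.+1%:R / l) <= l / 2.
Proof.
move=> l0; pose phi x : R := Num.max 0 (l - x) ^+ 2 / (2 * l).
have step i : Num.max 0 (1 - i.+1%:R / l) <= phi i%:R - phi i.+1%:R.
  rewrite /phi -mulrBl ler_pdivlMr ?mulr_gt0 // mulrCA maxr_pMl; last exact: ltW.
  rewrite mul0r mulrBl mul1r divfK ?gt_eqF // -(natr1 i); move: i%:R => x.
  have [h1|h1] := leP 0 (l - x); have [h2|h2] := leP 0 (l - (x + 1)); nra.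
apply: (@le_trans _ _ (\sum_(0 <= i < N) (phi i%:R - phi i.+1%:R))).
  exact: ler_sum.
rewrite -(opprK (\sum_(0 <= i < N) _)) -sumrN.
rewrite (eq_bigr (fun i => phi i.+1%:R - phi i%:R)) => [|i _]; last first.
  by rewrite opprB.
rewrite (telescope_sumr (fun i => phi i%:R)) // opprB /phi subr0.
have -> : Num.max 0 l = l by apply: max_r; exact: ltW.
have -> : l ^+ 2 / (2 * l) = l / 2 by field; rewrite gt_eqF.
by rewrite gerBl divr_ge0 ?sqr_ge0 // mulr_ge0 // ltW.
Qed.

Lemma cov_le (R : realType) (k m : nat) : (0 < m)%N ->
  (cov k (std_grid R m.+1))%:R <=
    Num.sqrt 2 * (k%:R * m%:R) + k%:R + 4 * m%:R :> R.
Proof.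
move=> m0; have m0' : 0 < m%:R :> R by rewrite ltr0n.
have q2 : Num.sqrt 2 ^+ 2 = 2 :> R by rewrite sqr_sqrtr.
have q0 : 0 < Num.sqrt 2 :> R by rewrite sqrtr_gt0.
pose l : R := Num.sqrt 2 * m%:R; have l0 : 0 < l by rewrite mulr_gt0.
pose fa i : R := k%:R * (i.+1%:R / l).
pose fb i : R := k%:R * (1 - i.+1%:R / l).
pose ga i := round_up R (fa i); pose gb i := round_up R (fb i).
pose s := parallel_lines R 1 0 ga m ++ parallel_lines R 0 1 ga m ++
          parallel_lines R 1 1 gb (2 * m).
have sP L : L \in s -> exists i a b,
    [/\ L = line R a b i.+1%:R & (a, b) != (0, 0)].
  rewrite !mem_cat => /or3P[] /parallel_linesP[i ->].
  - by exists i, 1, 0; rewrite xpair_eqE oner_eq0.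
  - by exists i, 0, 1; rewrite xpair_eqE oner_eq0 andbF.
  - by exists i, 1, 1; rewrite xpair_eqE oner_eq0.
have covs : kcover k (std_grid R m.+1) (seq_mset s).
  split=> [L|p pG p0|L].
  - rewrite (perm_mem (perm_eq_seq_mset s)) => /sP[i [a [b [-> ab0]]]].
    by exists a, b, i.+1%:R.
  - rewrite (permP (perm_eq_seq_mset s)) -(ler_nat R) !count_cat !natrD.
    have [i [j [im jm pE]]] := std_gridP R m p pG.
    (* The zero offset is included: it asks for no line at all. *)
    have axis (a b : R) h : (h <= m)%N -> a * p.1 + b * p.2 = h%:R ->
        k%:R * (h%:R / l) <= (count (fun L : set (R * R) => p \in L)
          (parallel_lines R a b ga m))%:R.
      case: h => [|h] hm ph; first by rewrite mul0r mulr0.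
      apply: le_trans (round_up_ge R (fa h)) _; rewrite ler_nat.
      exact: (count_parallel_lines _ _ _ ga).
    have h1 := axis 1 0 i im; have h2 := axis 0 1 j jm.
    have [h ijh] : exists h, (i + j = h.+1)%N.
      case: (i + j)%N (addn_eq0 i j) => [/esym/andP[/eqP i0 /eqP j0]|h _].
        by move: p0; rewrite pE i0 j0 eqxx.
      by exists h.
    have h3 := count_parallel_lines R 1 1 gb (2 * m) p h.
    have : k%:R <= k%:R * (i%:R / l) + (k%:R * (j%:R / l) + fb h).
      by rewrite /fb -ijh natrD; lra.
    move=> /le_trans; apply; apply: lerD; last apply: lerD.
    + by apply: h1; rewrite pE /=; lra.
    + by apply: h2; rewrite pE /=; lra.
    + apply: le_trans (round_up_ge R (fb h)) _; rewrite ler_nat.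
      by apply: h3; [rewrite pE /= -ijh natrD; lra | lia].
  - rewrite (perm_mem (perm_eq_seq_mset s)) => /sP[i [a [b [-> ab0]]]].
    by rewrite mem_line !mulr0 addr0 eq_sym pnatr_eq0.
apply: (@le_trans _ _ (size s)%:R).
  by rewrite ler_nat -(perm_size (perm_eq_seq_mset s)); exact: cov_le_size.
have sumfa : \sum_(0 <= i < m) Num.max 0 (fa i) =
    k%:R * ((m%:R * (m%:R + 1)) / 2 / l).
  rewrite (eq_bigr (fun i : nat => k%:R * ((i%:R + 1) / l))) => [|i _].
    rewrite -mulr_sumr -mulr_suml; congr (_ * (_ / _)).
    elim: (m) => [|n IH]; first by rewrite big_nil; lra.
    by rewrite big_nat_recr //= IH -natr1; field.
  by rewrite natr1; apply: max_r; rewrite mulr_ge0 // divr_ge0 // ltW.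
have sumfb : \sum_(0 <= i < 2 * m) Num.max 0 (fb i) <= k%:R * (l / 2).
  rewrite (eq_bigr (fun i : nat => k%:R * Num.max 0 (1 - i.+1%:R / l))).
    by rewrite -mulr_sumr ler_wpM2l // sum_max_le.
  by move=> i _; rewrite maxr_pMr // mulr0.
have := size_round_up_lines R 1 1 fb (2 * m).
have := size_round_up_lines R 0 1 fa m.
have := size_round_up_lines R 1 0 fa m.
rewrite !size_cat natrM !natrD !sumfa.
have -> : k%:R * (m%:R * (m%:R + 1) / 2 / l) =
    k%:R * (m%:R + 1) * Num.sqrt 2 / 4 :> R.
  rewrite /l; have -> : k%:R * (m%:R + 1) * Num.sqrt 2 / 4 =
      k%:R * (m%:R + 1) * Num.sqrt 2 ^+ 2 / (4 * Num.sqrt 2) :> R.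
    by field; rewrite gt_eqF.
  by rewrite q2; field; rewrite !gt_eqF.
have kq : k%:R * Num.sqrt 2 <= k%:R * 2 :> R.
  by rewrite ler_wpM2l //; nra.
move: sumfb; rewrite /l; lra.
Qed.

(** * Error terms *)

Lemma cvg_inv_pred (R : realType) :
  (n%:R - 1 : R)^-1 @[n --> \oo] --> (0 : R).
Proof.
rewrite -(cvg_shiftn 2); apply: cvg_trans (@cvg_harmonic R).
by apply: near_eq_cvg; apply: nearW => n; rewrite /harmonic /= addn2 -(natr1 n.+1) addrK.
Qed.

Lemma cvg_inv (R : realType) : (n%:R : R)^-1 @[n --> \oo] --> (0 : R).
Proof. by rewrite -cvg_shiftS; exact: cvg_harmonic. Qed.

Theorem theorem1p4 (R : realType) :
  exists e1 e2 : nat -> nat -> R,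
    [/\ e1 nk.1 nk.2 @[nk --> (\oo, \oo)] --> (0 : R),
        e2 nk.1 nk.2 @[nk --> (\oo, \oo)] --> (0 : R)
      & forall n k : nat, (2 <= n)%N -> (2 <= k)%N ->
          (2 - expR (- (1 / 2)) + e1 n k) * (k%:R * (n%:R - 1))
            <= (cov k (std_grid R n))%:R
          /\ (cov k (std_grid R n))%:R
            <= (Num.sqrt 2 + e2 n k) * (k%:R * (n%:R - 1))].
Proof.
have cvg1 : (nk.1%:R - 1 : R)^-1 @[nk --> ((\oo : set_system nat),
    (\oo : set_system nat))] --> (0 : R).
  exact: (cvg_comp _ _ cvg_fst (cvg_inv_pred R)).
have cvg2 : (nk.2%:R : R)^-1 @[nk --> ((\oo : set_system nat),
    (\oo : set_system nat))] --> (0 : R).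
  exact: (cvg_comp _ _ cvg_snd (cvg_inv R)).
exists (fun n _ => - (n%:R - 1)^-1), (fun n k => (n%:R - 1)^-1 + 4 * k%:R^-1).
split=> [||[//|m] k m1 k2].
- by rewrite -[0]oppr0; exact: cvgN.
- rewrite -[0]addr0 -[X in _ + X](mulr0 (4 : R)).
  by apply: cvgD cvg1 _; apply: cvgM cvg2; exact: cvg_cst.
- have m0 : (0 < m)%N by [].
  have m0' : m%:R != 0 :> R by rewrite pnatr_eq0 -lt0n.
  have k0' : k%:R != 0 :> R by rewrite pnatr_eq0 -lt0n ltnW.
  rewrite -(natr1 m) addrK; split.
    apply: le_trans (cov_ge R k m m0).
    by rewrite le_eqVlt; apply/orP; left; apply/eqP; field.
  apply: (le_trans (cov_le R k m m0)).
  by rewrite le_eqVlt; apply/orP; left; apply/eqP; field; rewrite m0' k0'.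
Qed.
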